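(* Let $A_1,A_2,A_3,A_4,B_1,B_2,B_3,B_4\subseteq\mathbf{Z}_{247}$ be the explicit subsets defined in the context. Then each of the quadruples $(A_1,A_2,A_3,A_4)$ and $(B_1,B_2,B_3,B_4)$ is a $4-(247;123,111,123,114;224)$ supplementary difference set in $\mathbf{Z}_{247}$.
   Context: $\mathbf{Z}_n$ denotes the ring (and additive group) of integers modulo $n$, and $\mathbf{Z}_n^*$ its group of invertible elements. A quadruple $(X_1,X_2,X_3,X_4)$ of subsets of $\mathbf{Z}_v$ is a $4-(v;k_1,k_2,k_3,k_4;\lambda)$ supplementary difference set (SDS, also called a difference family) if $|X_i|=k_i$ for $i=1,2,3,4$ and for every nonzero $g\in\mathbf{Z}_v$ the total number of triples $(i,x,y)$ with $i\in\{1,2,3,4\}$, $x,y\in X_i$ and $x-y=g$ equals $\lambda$. Let $n=247$ and let $H=\{1,9,16,55,61,81,139,144,235\}$, a cyclic subgroup of order $9$ of $\mathbf{Z}_{247}^*$, acting on $\mathbf{Z}_{247}$ by multiplication. Its $30$ nonzero orbits $\alpha_0,\dots,\alpha_{29}$ are enumerated as follows: $\alpha_0=H$, $\alpha_2=\{2,18,31,32,41,110,122,162,223\}$, $\alpha_4=\{3,27,48,165,170,183,185,211,243\}$, $\alpha_6=\{5,28,45,58,80,158,187,201,226\}$, $\alpha_8=\{6,54,83,93,96,119,123,175,239\}$, $\alpha_{10}=\{7,20,63,73,112,138,163,180,232\}$, $\alpha_{12}=\{10,56,69,90,116,127,155,160,205\}$, $\alpha_{14}=\{11,47,99,102,111,115,150,176,177\}$,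 $\alpha_{16}=\{13,52,65,78,91,117,143,208,221\}$, $\alpha_{18}=\{14,29,40,79,113,126,146,217,224\}$, $\alpha_{20}=\{17,25,43,49,140,142,153,194,225\}$, $\alpha_{22}=\{19,57,171\}$, $\alpha_{24}=\{33,34,37,50,59,86,98,141,203\}$, $\alpha_{26}=\{35,66,68,74,100,118,159,172,196\}$, $\alpha_{28}=\{38,95,114\}$, and $\alpha_{2i+1}=-\alpha_{2i}$ (mod $247$) for $0\le i\le 14$. For $k=1,2,3,4$ set $A_k=\bigcup_{i\in J_k}\alpha_i$ and $B_k=\bigcup_{i\in L_k}\alpha_i$, where $J_1=\{0,2,4,7,8,10,12,15,16,18,20,23,25,27,29\}$, $J_2=\{0,2,7,9,11,12,14,15,16,18,20,22,26\}$, $J_3=\{2,3,4,12,13,14,15,16,18,20,23,24,26,27,29\}$, $J_4=\{0,3,4,6,10,11,12,14,18,19,20,22,25,29\}$, $L_1=\{0,3,5,7,8,11,12,15,17,18,21,22,24,27,29\}$, $L_2=\{3,5,6,8,11,13,14,15,16,19,26,27,29\}$, $L_3=\{0,1,2,4,5,7,11,13,14,15,22,23,24,26,27\}$, $L_4=\{0,3,8,9,10,11,13,17,19,24,25,27,28,29\}$. *)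

(* Defs.v *)
From mathcomp Require Import all_boot all_algebra.

Set Implicit Arguments.
Unset Strict Implicit.
Unset Printing Implicit Defensive.

Import GRing.Theory.
Local Open Scope ring_scope.

(* 4-(v; k_0, k_1, k_2, k_3; lambda) supplementary difference sets; the four
   subsets and their sizes are indexed by 'I_4, i.e. 0..3 instead of 1..4.
   Pitfall: 'Z_v is the ring of integers mod v only for v > 1, hence the first
   conjunct. *)
Definition is_SDS4 (v : nat) (k : 4.-tuple nat) (lambda : nat)
    (X : 4.-tuple {set 'Z_v}) : Prop :=
  [/\ (1 < v)%N,
      forall i : 'I_4, #|tnth X i| = tnth k i
    & forall g : 'Z_v, g != 0 ->
        #|[set t : 'I_4 * 'Z_v * 'Z_v |
            [&& t.1.2 \in tnth X t.1.1, t.2 \in tnth X t.1.1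
              & t.1.2 - t.2 == g]]| = lambda].

(* The i-th entry lists the representatives in 0..246 of the orbit of even
   index 2i; the entry of index 0 is the subgroup H itself. *)
Definition even_orbits : seq (seq nat) :=
  [:: [:: 1; 9; 16; 55; 61; 81; 139; 144; 235];
      [:: 2; 18; 31; 32; 41; 110; 122; 162; 223];
      [:: 3; 27; 48; 165; 170; 183; 185; 211; 243];
      [:: 5; 28; 45; 58; 80; 158; 187; 201; 226];
      [:: 6; 54; 83; 93; 96; 119; 123; 175; 239];
      [:: 7; 20; 63; 73; 112; 138; 163; 180; 232];
      [:: 10; 56; 69; 90; 116; 127; 155; 160; 205];
      [:: 11; 47; 99; 102; 111; 115; 150; 176; 177];
      [:: 13; 52; 65; 78; 91; 117; 143; 208; 221];
      [:: 14; 29; 40; 79; 113; 126; 146; 217; 224];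
      [:: 17; 25; 43; 49; 140; 142; 153; 194; 225];
      [:: 19; 57; 171];
      [:: 33; 34; 37; 50; 59; 86; 98; 141; 203];
      [:: 35; 66; 68; 74; 100; 118; 159; 172; 196];
      [:: 38; 95; 114]]%N.

(* Each listed set is the orbit of its first element under multiplication by
   H, and the sets together with their negatives partition 1..246. *)
Lemma even_orbits_orbit :
  all (fun o => perm_eq o
        (undup [seq (h * head 0 o) %% 247 | h <- head [::] even_orbits])%N)
    even_orbits.
Proof. by vm_compute. Qed.

Lemma even_orbits_partition :
  perm_eq (flatten even_orbits ++ [seq 247 - n | n <- flatten even_orbits])%N
    (iota 1 246).
Proof. by vm_compute. Qed.

Definition even_orbit (i : nat) : {set 'Z_247} :=
  [set x in [seq n%:R | n <- nth [::] even_orbits i]].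

Definition alpha (i : nat) : {set 'Z_247} :=
  if odd i then [set - x | x in even_orbit i./2] else even_orbit i./2.

Definition union_alpha (J : seq nat) : {set 'Z_247} :=
  \bigcup_(i <- J) alpha i.

Definition A1 := union_alpha
  [:: 0; 2; 4; 7; 8; 10; 12; 15; 16; 18; 20; 23; 25; 27; 29]%N.
Definition A2 := union_alpha
  [:: 0; 2; 7; 9; 11; 12; 14; 15; 16; 18; 20; 22; 26]%N.
Definition A3 := union_alpha
  [:: 2; 3; 4; 12; 13; 14; 15; 16; 18; 20; 23; 24; 26; 27; 29]%N.
Definition A4 := union_alpha
  [:: 0; 3; 4; 6; 10; 11; 12; 14; 18; 19; 20; 22; 25; 29]%N.

Definition B1 := union_alpha
  [:: 0; 3; 5; 7; 8; 11; 12; 15; 17; 18; 21; 22; 24; 27; 29]%N.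
Definition B2 := union_alpha
  [:: 3; 5; 6; 8; 11; 13; 14; 15; 16; 19; 26; 27; 29]%N.
Definition B3 := union_alpha
  [:: 0; 1; 2; 4; 5; 7; 11; 13; 14; 15; 22; 23; 24; 26; 27]%N.
Definition B4 := union_alpha
  [:: 0; 3; 8; 9; 10; 11; 13; 17; 19; 24; 25; 27; 28; 29]%N.

(* Main.v *)
Require Import Defs.
From mathcomp Require Import all_boot all_algebra.

Set Implicit Arguments.
Unset Strict Implicit.
Unset Printing Implicit Defensive.

Import GRing.Theory.

(** Being a supplementary difference set is a finite property, and the proof
    is the direct verification of the 246 difference counts of each quadruple;
    the point is to put it in a form where evaluation is cheap.  The number of
    pairs (x, y) in X with x - y = g is #|X :&: (X - g)|, so it depends on X
    only through its characteristic bit vector: it is the periodic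
    autocorrelation of that vector at shift g.  The lemma [card_differences]
    says this, and [is_SDS4_represents] turns the definition of a
    supplementary difference set into a boolean test on four bit vectors: the
    sizes are numbers of true bits, and the four autocorrelations add up to
    lambda at every nonzero shift.

    What remains is to compute the bit vectors of unions of the orbits
    alpha_i.  The orbits are defined through images in the ring of integers
    modulo 247; [mem_union_alpha] rewrites membership as membership of the
    residue in an explicit list of natural numbers, from which the vector is
    filled in.  The test is then run by the kernel. *)

(** * Subsets of a cyclic group as bit vectors *)

(** The size is part of the relation because bits beyond n would spoil the
    rotations. *)
Definition represents n (b : seq bool) (X : {set 'I_n}) : Prop :=
  size b = n /\ forall x, (x \in X) = nth false b x.

Definition autocorrelation (g : nat) (b : seq bool) : nat :=
  count (fun p => p.1 && p.2) (zip b (rot g b)).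

Lemma card_represents n b (X : {set 'I_n}) :
  represents b X -> #|X| = count id b.
Proof.
case=> sz mem_b.
rewrite -sum1_count (big_nth false) big_mkord sz -sum1_card.
by apply: eq_bigl => x; rewrite mem_b.
Qed.

Lemma nth_rot_modn b g y : g <= size b -> y < size b ->
  nth false (rot g b) y = nth false b ((y + g) %% size b).
Proof.
move=> le_g lt_y; rewrite /rot nth_cat size_drop nth_drop ltn_subRL addnC.
case: ltnP => [lt_yg | le_yg]; first by rewrite modn_small.
have lt_yg_g : y + g - size b < g by rewrite ltn_subLR // ltn_add2r.
rewrite subnBA // nth_take // -{2}(subnKC le_yg) modnDl modn_small //.
exact: leq_trans lt_yg_g le_g.
Qed.

(** Addition in 'Z_n.+2 is addition of residues modulo n.+2, which is what a
    cyclic rotation does to the indices. *)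
Lemma represents_rot n b (X : {set 'Z_n.+2}) (g : 'Z_n.+2) :
  represents b X ->
  represents (n := n.+2) (rot g b) [set y | (y + g \in X)%R].
Proof.
case=> sz mem_b; split=> [|y]; first by rewrite size_rot.
have lt_g : g < size b by rewrite sz ltn_ord.
by rewrite inE mem_b (nth_rot_modn (ltnW lt_g)) ?sz // ltn_ord.
Qed.

Lemma represents_setI n b c (X Y : {set 'I_n}) :
  represents b X -> represents c Y ->
  represents [seq p.1 && p.2 | p <- zip b c] (X :&: Y).
Proof.
move=> [szb mem_b] [szc mem_c].
have sz : size (zip b c) = n by rewrite size_zip szb szc minnn.
split=> [|x]; first by rewrite size_map.
rewrite inE mem_b mem_c (nth_map (false, false)) ?sz //.
by rewrite nth_zip ?szb ?szc.
Qed.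

(** A pair with difference g is determined by its second component y, and
    (y + g, y) lies in X * X exactly when y lies in X and in the translate
    X - g, whose bit vector is that of X rotated by g. *)
Lemma card_differences n b (X : {set 'Z_n.+2}) g : represents b X ->
  #|[set t : 'Z_n.+2 * 'Z_n.+2 |
      [&& t.1 \in X, t.2 \in X & (t.1 - t.2 == g)%R]]|
    = autocorrelation g b.
Proof.
move=> rep_b; rewrite /autocorrelation -(count_map _ id).
rewrite -(card_represents (represents_setI rep_b (represents_rot g rep_b))).
have inj : injective (fun y : 'Z_n.+2 => (y + g, y)%R) by move=> y z [].
rewrite -(card_imset _ inj); apply: eq_card => -[x y]; rewrite !inE /=.
apply/and3P/imsetP => [[Xx Xy /eqP <-] | [z]].
  by exists y; rewrite ?inE ?Xy addrC subrK ?Xx.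
by rewrite !inE => /andP[Xz Xzg] [-> ->]; rewrite Xzg Xz addrAC subrr add0r.
Qed.

(** The triples counted in the definition are sorted by their first component
    i, and those over i are the pairs counted by [card_differences] for the
    i-th set. *)
Lemma is_SDS4_represents n (k : 4.-tuple nat) lambda
    (X : 4.-tuple {set 'Z_n.+2}) (b : 4.-tuple (seq bool)) :
  (forall i, represents (n := n.+2) (tnth b i) (tnth X i)) ->
  map (count id) b = k ->
  all (fun g => sumn (map (autocorrelation g) b) == lambda) (iota 1 n.+1) ->
  is_SDS4 k lambda X.
Proof.
move=> rep_b card_b /allP sum_b; split=> // [i | g nz_g].
  rewrite (card_represents (rep_b i)) (tnth_nth 0) -card_b.
  by rewrite (nth_map [::]) ?size_tuple // -tnth_nth.
have g_range : nat_of_ord g \in iota 1 n.+1.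
  by rewrite mem_iota add1n ltn_ord andbT lt0n.
rewrite -(eqP (sum_b _ g_range)) sumnE big_map big_tuple -sum1_card.
rewrite (partition_big (fun t => t.1.1) xpredT) //=.
apply: eq_bigr => i _; rewrite -(card_differences _ (rep_b i)) sum1dep_card.
have inj : injective (fun t : 'Z_n.+2 * 'Z_n.+2 => (i, t.1, t.2)).
  by move=> [x y] [x' y'] [-> ->].
rewrite -(card_imset _ inj); apply: eq_card => -[[j x] y].
rewrite !inE /=; apply/andP/imsetP => [[Sxy /eqP eq_j] | [[x' y']]].
  by exists (x, y); rewrite ?inE /= -eq_j.
by rewrite inE => Sxy [-> -> ->].
Qed.

(** * Bit vectors of unions of orbits *)

(** Both reductions modulo 247 follow the arithmetic of 'Z_247 literally: the
    inner one comes from the cast of n, the outer one from the opposite.  This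
    makes the residues correct without any bound on the listed numbers. *)
Definition orbit_residues (i : nat) : seq nat :=
  let o := nth [::] even_orbits i./2 in
  if odd i then [seq (247 - n %% 247) %% 247 | n <- o]
  else [seq n %% 247 | n <- o].

Lemma mem_even_orbit i (x : 'Z_247) :
  (x \in even_orbit i)
    = (nat_of_ord x \in [seq n %% 247 | n <- nth [::] even_orbits i]).
Proof.
rewrite inE -(mem_map val_inj) -map_comp.
by congr (_ \in _); apply: eq_map => n; rewrite /= val_Zp_nat.
Qed.

Lemma mem_alpha i (x : 'Z_247) :
  (x \in alpha i) = (nat_of_ord x \in orbit_residues i).
Proof.
rewrite /alpha /orbit_residues; case: ifP => _; last exact: mem_even_orbit.
apply/imsetP/mapP => [[y] | [n o_n x_n]].
  by rewrite mem_even_orbit => /mapP[n o_n y_n] ->; exists n; rewrite //= y_n.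
exists n%:R%R.
  by rewrite mem_even_orbit val_Zp_nat //; apply/mapP; exists n.
by apply: val_inj; rewrite [LHS]x_n /= val_Zp_nat.
Qed.

Lemma mem_union_alpha J (x : 'Z_247) :
  (x \in union_alpha J) = (nat_of_ord x \in flatten (map orbit_residues J)).
Proof.
rewrite /union_alpha; elim: J => [|i J IH]; first by rewrite big_nil inE.
by rewrite big_cons inE IH mem_alpha /= mem_cat.
Qed.

(** Setting the bits one by one evaluates much faster than testing each of the
    n indices for membership in s, which would compare unary numbers. *)
Definition bits_of n (s : seq nat) : seq bool :=
  foldr (fun k b => set_nth false b k true) (nseq n false) s.

Lemma nth_bits_of n s k : nth false (bits_of n s) k = (k \in s).
Proof.
elim: s => [|m s IH]; first by rewrite nth_nseq if_same.
by rewrite /= nth_set_nth /= inE IH; case: eqP.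
Qed.

Lemma size_bits_of n s : all (gtn n) s -> size (bits_of n s) = n.
Proof.
elim: s => [|m s IH /= /andP[lt_m /IH sz]]; first by rewrite size_nseq.
by rewrite size_set_nth sz; apply/maxn_idPr.
Qed.

Definition union_bits J := bits_of 247 (flatten (map orbit_residues J)).

Lemma represents_union_alpha J :
  represents (n := 247) (union_bits J) (union_alpha J).
Proof.
split=> [|x]; last by rewrite nth_bits_of mem_union_alpha.
apply: size_bits_of; apply/allP => m /flatten_mapP[i _].
by rewrite /orbit_residues; case: ifP => _ /mapP[n _ ->] /=; rewrite ltn_mod.
Qed.

(** Once the index lists are explicit, both premises are closed computations
    on lists of booleans. *)
Lemma is_SDS4_union_alpha (k : 4.-tuple nat) lambda (J : 4.-tuple (seq nat)) :
  map (count id) (map union_bits J) = k ->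
  all (fun g => sumn (map (autocorrelation g) (map union_bits J)) == lambda)
    (iota 1 246) ->
  is_SDS4 k lambda (map_tuple union_alpha J).
Proof.
move=> card_b sum_b.
apply: (is_SDS4_represents (n := 245) (b := map_tuple union_bits J)) => // i.
by rewrite !tnth_map; apply: represents_union_alpha.
Qed.

Theorem proposition4p1 :
  is_SDS4 [tuple 123; 111; 123; 114] 224 [tuple A1; A2; A3; A4] /\
  is_SDS4 [tuple 123; 111; 123; 114] 224 [tuple B1; B2; B3; B4].
Proof.
set k := [tuple _; _; _; _].
have sdsA : is_SDS4 k 224 (map_tuple union_alpha [tuple
    [:: 0; 2; 4; 7; 8; 10; 12; 15; 16; 18; 20; 23; 25; 27; 29];
    [:: 0; 2; 7; 9; 11; 12; 14; 15; 16; 18; 20; 22; 26];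
    [:: 2; 3; 4; 12; 13; 14; 15; 16; 18; 20; 23; 24; 26; 27; 29];
    [:: 0; 3; 4; 6; 10; 11; 12; 14; 18; 19; 20; 22; 25; 29]]).
  by apply: is_SDS4_union_alpha; vm_compute.
have sdsB : is_SDS4 k 224 (map_tuple union_alpha [tuple
    [:: 0; 3; 5; 7; 8; 11; 12; 15; 17; 18; 21; 22; 24; 27; 29];
    [:: 3; 5; 6; 8; 11; 13; 14; 15; 16; 19; 26; 27; 29];
    [:: 0; 1; 2; 4; 5; 7; 11; 13; 14; 15; 22; 23; 24; 26; 27];
    [:: 0; 3; 8; 9; 10; 11; 13; 17; 19; 24; 25; 27; 28; 29]]).
  by apply: is_SDS4_union_alpha; vm_compute.
(* The two tuples of sets differ only in their size proofs. *)
split; first by congr (is_SDS4 _ _ _): sdsA; apply: val_inj.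
by congr (is_SDS4 _ _ _): sdsB; apply: val_inj.
Qed.
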